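(* Let $u(\cdot,\cdot;\psi)$, $g$, $K$ and $\mathcal D_K$ be as defined in the context, and let the standing assumptions of the context hold. For $q\in\mathcal D_K$, the identity $u(x,T;q)=g(x)$ (for $x\in\Omega$) holds if and only if $Kq=q$.
   Context: Setting. $\Omega=(0,1)\times(0,1)\subset\mathbb R^2$, $x=(x_1,x_2)$, $T>0$, $Q_T=\Omega\times(0,T]$. Boundary pieces: $l_1=[0,1]\times\{0\}$, $l_2=\{1\}\times(0,1)$, $l_3=[0,1]\times\{1\}$, $l_4=\{0\}\times(0,1)$; $\vec n$ is the outward unit normal. For a drift coefficient $\psi$, $u(x,t;\psi)$ denotes the solution $u$ of $$(\partial_t-\Delta+\psi(x)\partial_{x_1}+C_p)u(x,t)=f(x)\ \text{ in }\Omega\times(0,T],\qquad u(x,0)=u_0(x)\ \text{ in }\Omega,$$ with boundary conditions on $\partial\Omega\times(0,T]$: $u=b_1(x,t)$ on $l_1$, $u=b_3(x,t)$ on $l_3$, $\frac{\partial u}{\partial\vec n}=b_2(x,t)$ on $l_2$, $\frac{\partial u}{\partial\vec n}=b_4$ on $l_4$, where $b_4$ is a constant. The source $f$, initial value $u_0$, boundary data and constant $C_p$ are given. The data are $g(x):=u(x,T;q^* )$, $x\in\Omega$, where $q^*$ is the exact (unknown) drift. Here $C^j(\Omega)$ is the space of $j$ times continuously differentiable functions with finite norm $\|\cdot\|_{C^j(\Omega)}$. For a boundary segment $\Gamma$, $H^{r,s}(\Gamma\times(0,T)):=L^2(0,T;H^r(\Gamma))\cap H^s(0,T;L^2(\Gamma))$.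 Operator: $$K\psi=\frac{f(x)-\partial_tu(x,T;\psi)+\Delta g(x)-C_pg(x)}{\partial_{x_1}g(x)},\qquad \mathcal D_K=\Big\{\psi\in C^1(\Omega):\ \psi\le\frac{f+\Delta g-C_pg}{\partial_{x_1}g}\text{ on }\Omega\Big\}.$$ Inequalities between functions are pointwise on $\Omega$. Standing assumptions. Regularity and compatibility: the drift coefficient is in $W^{1,\infty}(\Omega)$; $u_0\in H^1(\Omega)$; $f\in W^{1,\infty}(\Omega)$; $b_1,b_3\in H^{3/2,3/4}((l_1\cup l_3)\times(0,T))$; $b_2,b_4\in H^{1/2,1/4}((l_2\cup l_4)\times(0,T))$; $u_0=b_1(\cdot,0)$ on $l_1$ and $u_0=b_3(\cdot,0)$ on $l_3$; $\partial_{x_1}b_1$, $b_2$, $\partial_{x_1}b_3$ and $-b_4$ are continuous Dirichlet boundary data on $l_1,l_2,l_3,l_4$ respectively; $\partial^2_{x_1t}b_1\in C(\overline{l_1}\times(0,T])$, $\partial_tb_2\in C(\overline{l_2}\times(0,T])$, $\partial^2_{x_1t}b_3\in C(\overline{l_3}\times(0,T])$; and, more generally, the source term and boundary data possess sufficient regularity and compatibility at $t=0$ that all derivatives appearing in the problems obtained by differentiating the equation (those for $\partial_tu$, $\partial_{x_1}u$, $\partial^2_{x_1t}u$) are well defined. Sign conditions: (a) $q^*\in C^1(\Omega)$ and $\|q^*\|_{C^1(\Omega)}\le M$, where $M$ is a sufficiently large constant. (b) $C_p>M$. (c) $\partial_{x_1}b_j\ge0$, $\partial^2_{x_1t}b_j\ge0$,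 $\partial_tb_j\ge0$ on $l_j\times(0,T]$, $j=1,3$. (d) $b_2\ge0$, $\partial_tb_2\ge 0$, $\partial_tb_2>0$ on $l_2\times(0,T]$, and the constant $b_4$ is strictly negative. (e) $u_0\in C^3(\Omega)$, $\partial_{x_1}u_0\ge0$ on $\Omega$, and $C_0:=\max_{0\le j\le3}\|u_0\|_{C^j(\Omega)}<\infty$. (f) $f\ge(1+M+C_p)C_0$ and $\partial_{x_1}f\ge(1+2M+C_p)C_0$ on $\Omega$. *)

(* Defs.v *)
From HB Require Import structures.
From mathcomp Require Import all_boot all_order all_algebra.
From mathcomp Require Import all_classical all_reals all_analysis.

Set Implicit Arguments.
Unset Strict Implicit.
Unset Printing Implicit Defensive.
Import Order.TTheory GRing.Theory Num.Theory.
Import numFieldNormedType.Exports.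
Local Open Scope classical_set_scope.
Local Open Scope ring_scope.

(* Spatial functions are total functions on R * R of which only the values on
   the closed unit square matter; space-time functions are curried,
   [R * R -> R -> R], and only their values for times in [0, T] matter.  For
   this reason derivatives are taken inside the closed interval over which the
   variable ranges: they are the usual ones at interior points (see
   [derivable_in_interior] and [derive_in_interior]) and one-sided at the
   endpoints, e.g. for the time derivative at t = T and for the Neumann
   conditions at x_1 = 0 and x_1 = 1. *)

Definition derivable_in {R : realType} (I : set R) (f : R -> R) (a : R) : Prop :=
  cvg ((f s - f a) / (s - a) @[s --> within I a^']).

Definition derive_in {R : realType} (I : set R) (f : R -> R) (a : R) : R :=
  lim ((f s - f a) / (s - a) @[s --> within I a^']).

Lemma quotient_in_interior {R : realType} (I : set R) (f : R -> R) (a : R) :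
  I° a ->
  ((f s - f a) / (s - a) @[s --> within I a^'])
  = (h^-1 *: (f (h + a) - f a) @[h --> (0 : R)^']).
Proof.
move=> Ia; apply/funext => S; apply/propext; split=> HS.
- have {}HS : \forall s \near a, s != a -> I s -> S ((f s - f a) / (s - a)).
    exact: HS.
  have {}HS : \forall s \near a, s != a -> S ((f s - f a) / (s - a)).
    have nI : \forall s \near a, I s by exact: Ia.
    by apply: filterS2 HS nI => s Hs Is sa; exact: Hs.
  move: HS; rewrite (near_shift 0 a) => HS.
  suff : \forall h \near (0 : R), h != 0 -> S (h^-1 *: (f (h + a) - f a)) by [].
  apply: filterS HS => h /=; rewrite subr0 addrK [_ / h]mulrC => Hh h0.
  by apply: Hh; rewrite -subr_eq0 addrK.
- have {}HS : \forall h \near (0 : R), h != 0 -> S (h^-1 *: (f (h + a) - f a)).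
    exact: HS.
  move: HS; rewrite (near_shift a 0) => HS.
  suff : \forall s \near a, s != a -> I s -> S ((f s - f a) / (s - a)) by [].
  apply: filterS HS => s /=; rewrite sub0r subrK [_^-1 *: _]mulrC => Hs sa _.
  by apply: Hs; rewrite subr_eq0.
Qed.

Lemma derivable_in_interior {R : realType} (I : set R) (f : R -> R) (a : R) :
  I° a -> derivable_in I f a <-> derivable f a 1.
Proof.
move=> Ia; rewrite /derivable_in quotient_in_interior// /derivable.
by under [in X in _ <-> X]eq_fun do rewrite [_ *: 1]mulr1.
Qed.

Lemma derive_in_interior {R : realType} (I : set R) (f : R -> R) (a : R) :
  I° a -> derive_in I f a = derive1 f a.
Proof. by move=> Ia; rewrite /derive_in quotient_in_interior. Qed.

Definition Omega {R : realType} : set (R * R) := `]0, 1[ `*` `]0, 1[.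
Definition l1 {R : realType} : set (R * R) := `[0, 1] `*` [set 0].
Definition l2 {R : realType} : set (R * R) := [set 1] `*` `]0, 1[.
Definition l3 {R : realType} : set (R * R) := `[0, 1] `*` [set 1].
Definition l4 {R : realType} : set (R * R) := [set 0] `*` `]0, 1[.

Definition derivable1 {R : realType} (phi : R * R -> R) (x : R * R) : Prop :=
  derivable_in `[0, 1] (fun s => phi (s, x.2)) x.1.
Definition derivable2 {R : realType} (phi : R * R -> R) (x : R * R) : Prop :=
  derivable_in `[0, 1] (fun s => phi (x.1, s)) x.2.
Definition d1 {R : realType} (phi : R * R -> R) (x : R * R) : R :=
  derive_in `[0, 1] (fun s => phi (s, x.2)) x.1.
Definition d2 {R : realType} (phi : R * R -> R) (x : R * R) : R :=
  derive_in `[0, 1] (fun s => phi (x.1, s)) x.2.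

Definition laplacian {R : realType} (phi : R * R -> R) (x : R * R) : R :=
  d1 (d1 phi) x + d2 (d2 phi) x.

Definition dx1 {R : realType} (U : R * R -> R -> R) : R * R -> R -> R :=
  fun x t => d1 (U^~ t) x.
Definition dx2 {R : realType} (U : R * R -> R -> R) : R * R -> R -> R :=
  fun x t => d2 (U^~ t) x.
Definition dt {R : realType} (T : R) (U : R * R -> R -> R) : R * R -> R -> R :=
  fun x t => derive_in `[0, T] (U x) t.

Definition continuous_on {R : realType} (A : set ((R * R) * R))
    (U : R * R -> R -> R) : Prop :=
  {within A, continuous (fun z => U z.1 z.2)}.

Fixpoint Ck {R : realType} (j : nat) (phi : R * R -> R) : Prop :=
  {within Omega, continuous phi} /\
  match j with
  | 0%N => True
  | j'.+1 => [/\ forall x, Omega x -> derivable1 phi x /\ derivable2 phi x,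
                 Ck j' (d1 phi) & Ck j' (d2 phi)]
  end.

(* The sum over all multi-indices of order at most j of the sup norms; with
   this convention |Delta u| <= ||u||_{C^2}, without a factor 2. *)
Definition Cnorm {R : realType} (j : nat) (phi : R * R -> R) : \bar R :=
  (\sum_(a < j.+1) \sum_(b < j.+1 | (a + b <= j)%N)
     ereal_sup [set (`|iter a d1 (iter b d2 phi) x|%:E) | x in Omega])%E.

Definition Cspace {R : realType} (j : nat) (phi : R * R -> R) : Prop :=
  Ck j phi /\ (Cnorm j phi < +oo)%E.

Notation leb1 := (@lebesgue_measure _).
Notation leb2 := ((@lebesgue_measure _) \x (@lebesgue_measure _))%E.

Definition test_function {R : realType} (eta : R * R -> R) : Prop :=
  (forall j, Ck j eta) /\
  exists S : set (R * R),
    [/\ compact S, S `<=` Omega & forall x, ~ S x -> eta x = 0].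

Definition weak_derivative {R : realType}
    (d : (R * R -> R) -> (R * R -> R)) (phi psi : R * R -> R) : Prop :=
  forall eta, test_function eta ->
    \int[leb2]_(x in Omega) (phi x * d eta x)
    = - \int[leb2]_(x in Omega) (psi x * eta x).

Definition Lp_Omega {R : realType} (p : \bar R) (phi : R * R -> R) : Prop :=
  phi \_ Omega \in Lfun leb2 p.

(* W^{1,p}(Omega) *)
Definition W1p {R : realType} (p : \bar R) (phi : R * R -> R) : Prop :=
  Lp_Omega p phi /\
  exists phi1 phi2 : R * R -> R,
    [/\ Lp_Omega p phi1, Lp_Omega p phi2,
        weak_derivative d1 phi phi1 & weak_derivative d2 phi phi2].

(* Functions of (s, t), with s in (0,1) the coordinate along a side of the
   square and t in (0, T). *)

Definition L2_side {R : realType} (T : R) (beta : R -> R -> R) : Prop :=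
  (fun z : R * R => beta z.1 z.2) \_ (`]0, 1[ `*` `]0, T[) \in Lfun leb2 2%:E.

Definition side_weak_derivative {R : realType} (phi psi : R -> R) : Prop :=
  forall eta : R -> R,
    (forall n s, derivable (derive1n n eta) s 1) ->
    (exists S : set R,
       [/\ compact S, S `<=` `]0, 1[ & forall s, ~ S s -> eta s = 0]) ->
    \int[leb1]_(s in `]0, 1[) (phi s * derive1 eta s)
    = - \int[leb1]_(s in `]0, 1[) (psi s * eta s).

(* L^2(0, T; H^(k + theta)(0, 1)), 0 < theta < 1, with the Gagliardo
   (Sobolev-Slobodeckij) seminorm *)
Fixpoint L2_Hspace {R : realType} (T : R) (k : nat) (theta : R)
    (beta : R -> R -> R) : Prop :=
  L2_side T beta /\
  match k with
  | 0%N =>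
    (\int[leb1]_(t in `]0%R, T[) \int[leb1]_(s in `]0%R, 1%R[)
       \int[leb1]_(r in `]0%R, 1%R[)
         (`|beta s t - beta r t| ^+ 2 / `|s - r| `^ (1 + 2 * theta))%:E
     < +oo)%E
  | k'.+1 => exists beta' : R -> R -> R,
      {ae leb1, forall t, 0 < t < T ->
         side_weak_derivative (beta^~ t) (beta'^~ t)}
      /\ L2_Hspace T k' theta beta'
  end.

(* H^sigma(0, T; L^2(0, 1)), 0 < sigma < 1 *)
Definition Htime_L2 {R : realType} (T sigma : R) (beta : R -> R -> R) : Prop :=
  L2_side T beta /\
  (\int[leb1]_(s in `]0%R, 1%R[) \int[leb1]_(t in `]0%R, T[)
     \int[leb1]_(r in `]0%R, T[)
       (`|beta s t - beta s r| ^+ 2 / `|t - r| `^ (1 + 2 * sigma))%:E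
   < +oo)%E.

Definition Hspace {R : realType} (T : R) (k : nat) (theta sigma : R)
    (beta : R -> R -> R) : Prop :=
  L2_Hspace T k theta beta /\ Htime_L2 T sigma beta.

(* C^{2,1}(Omega x (0, T]) *)
Record C21 {R : realType} (T : R) (U : R * R -> R -> R) : Prop := {
  C21_space : forall t, 0 < t <= T -> Ck 2 (U^~ t);
  C21_time : forall x t, Omega x -> 0 < t <= T -> derivable_in `[0, T] (U x) t;
  C21_cont : continuous_on (Omega `*` `]0, T]) U;
  C21_cont_t : continuous_on (Omega `*` `]0, T]) (dt T U);
  C21_cont_1 : continuous_on (Omega `*` `]0, T]) (dx1 U);
  C21_cont_2 : continuous_on (Omega `*` `]0, T]) (dx2 U);
  C21_cont_11 : continuous_on (Omega `*` `]0, T]) (dx1 (dx1 U));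
  C21_cont_12 : continuous_on (Omega `*` `]0, T]) (dx1 (dx2 U));
  C21_cont_22 : continuous_on (Omega `*` `]0, T]) (dx2 (dx2 U)) }.

Record problem (R : realType) := Problem {
  final_time : R;
  Cp : R;
  source : R * R -> R;
  u0 : R * R -> R;
  b1 : R * R -> R -> R;
  b2 : R * R -> R -> R;
  b3 : R * R -> R -> R;
  b4 : R }.

Definition closed_cylinder {R : realType} (T : R) : set ((R * R) * R) :=
  closure Omega `*` `[0, T].

(* Where the time derivatives d_t u and d_{x1} d_t u of a solution are
   continuous: they attain their lateral boundary values for t > 0 and their
   initial values inside Omega.  Asking for continuity on the whole closed
   cylinder would contradict the sign conditions: for the drift q*,
   d_{x1} d_t u vanishes on l4 for t > 0, but its initial value
   d_{x1} (f + Delta u0 - q* d_{x1} u0 - Cp u0) is bounded below by a positive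
   constant. *)
Definition cylinder_without_bottom_edges {R : realType} (T : R) :
    set ((R * R) * R) :=
  (closure Omega `*` `]0, T]) `|` (Omega `*` `[0, T]).

(* All derivatives occurring in the problems solved by u, d_t u, d_{x1} u and
   d_{x1} d_t u exist in the classical sense. *)
Record regular {R : realType} (T : R) (U : R * R -> R -> R) : Prop := {
  regular_C21 : C21 T U;
  regular_C21_t : C21 T (dt T U);
  regular_C21_1 : C21 T (dx1 U);
  regular_C21_1t : C21 T (dx1 (dt T U));
  regular_cont : continuous_on (closed_cylinder T) U;
  regular_ex1 : forall x t, closed_cylinder T (x, t) -> derivable1 (U^~ t) x;
  regular_cont1 : continuous_on (closed_cylinder T) (dx1 U);
  regular_ext : forall x t, cylinder_without_bottom_edges T (x, t) ->
    derivable_in `[0, T] (U x) t;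
  regular_contt :
    continuous_on (cylinder_without_bottom_edges T) (dt T U);
  regular_ex1t : forall x t, cylinder_without_bottom_edges T (x, t) ->
    derivable1 (dt T U ^~ t) x;
  regular_cont1t :
    continuous_on (cylinder_without_bottom_edges T) (dx1 (dt T U)) }.

(* The outward normal derivative is d_{x1} on l2 and - d_{x1} on l4. *)
Record is_solution {R : realType} (P : problem R) (psi : R * R -> R)
    (U : R * R -> R -> R) : Prop := {
  sol_drift : W1p +oo%E psi;
  sol_regular : regular (final_time P) U;
  sol_eq : forall x t, Omega x -> 0 < t <= final_time P ->
    dt (final_time P) U x t - laplacian (U^~ t) x + psi x * d1 (U^~ t) x + Cp P * U x t
    = source P x;
  sol_init : forall x, Omega x -> U x 0 = u0 P x;
  sol_l1 : forall x t, l1 x -> 0 < t <= final_time P -> U x t = b1 P x t;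
  sol_l2 : forall x t, l2 x -> 0 < t <= final_time P -> d1 (U^~ t) x = b2 P x t;
  sol_l3 : forall x t, l3 x -> 0 < t <= final_time P -> U x t = b3 P x t;
  sol_l4 : forall x t, l4 x -> 0 < t <= final_time P -> - d1 (U^~ t) x = b4 P }.

(* on the Dirichlet datum b of the side l = [0, 1] x {c} *)
Record dirichlet_assumptions {R : realType} (P : problem R)
    (l : set (R * R)) (c : R) (b : R * R -> R -> R) : Prop := {
  dir_H : Hspace (final_time P) 1 (1 / 2) (3 / 4) (fun s t => b (s, c) t);
  dir_cont : continuous_on (l `*` `[0, final_time P]) b;
  dir_init : forall x, l x -> u0 P x = b x 0;
  dir_ex1 : forall x t, l x -> 0 < t <= final_time P -> derivable1 (b^~ t) x;
  dir_cont1 : continuous_on (l `*` `]0, final_time P]) (dx1 b);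
  dir_ext : forall x t, l x -> 0 < t <= final_time P -> derivable_in `[0, final_time P] (b x) t;
  dir_ex1t : forall x t, l x -> 0 < t <= final_time P -> derivable1 (dt (final_time P) b ^~ t) x;
  dir_cont1t : continuous_on (closure l `*` `]0, final_time P]) (dx1 (dt (final_time P) b));
  dir_sign : forall x t, l x -> 0 < t <= final_time P ->
    [/\ 0 <= dx1 b x t, 0 <= dx1 (dt (final_time P) b) x t & 0 <= dt (final_time P) b x t] }.

Definition C0 {R : realType} (P : problem R) : \bar R :=
  (\big[maxe/0]_(j < 4) Cnorm j (u0 P))%E.

Record standing_assumptions {R : realType} (P : problem R) (M : R)
    (qstar : R * R -> R) : Prop := {
  st_T : 0 < final_time P;
  st_u0_H1 : W1p 2%:E (u0 P);
  (* so that the values of u0 on the boundary are its traces *)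
  st_u0_closure : {within closure Omega, continuous (u0 P)};
  st_f_W : W1p +oo%E (source P);
  st_f_ex1 : forall x, Omega x -> derivable1 (source P) x;
  st_b1 : dirichlet_assumptions P l1 0 (b1 P);
  st_b3 : dirichlet_assumptions P l3 1 (b3 P);
  st_b2_H : Hspace (final_time P) 0 (1 / 2) (1 / 4) (fun s t => b2 P (1, s) t);
  st_b4_H : Hspace (final_time P) 0 (1 / 2) (1 / 4) (fun _ _ => b4 P);
  st_b2_cont : continuous_on (l2 `*` `]0, final_time P]) (b2 P);
  st_b2_ext : forall x t, closure l2 x -> 0 < t <= final_time P ->
    derivable_in `[0, final_time P] (b2 P x) t;
  st_b2_contt : continuous_on (closure l2 `*` `]0, final_time P]) (dt (final_time P) (b2 P));
  st_qstar : Cspace 1 qstar;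
  st_qstar_M : (Cnorm 1 qstar <= M%:E)%E;
  st_Cp : M < Cp P;
  st_b2_sign : forall x t, l2 x -> 0 < t <= final_time P ->
    [/\ 0 <= b2 P x t, 0 <= dt (final_time P) (b2 P) x t & 0 < dt (final_time P) (b2 P) x t];
  st_b4 : b4 P < 0;
  st_u0 : Cspace 3 (u0 P);
  st_u0_sign : forall x, Omega x -> 0 <= d1 (u0 P) x;
  st_C0 : (C0 P < +oo)%E;
  st_f : forall x, Omega x -> (1 + M + Cp P) * fine (C0 P) <= source P x;
  st_f1 : forall x, Omega x -> (1 + 2 * M + Cp P) * fine (C0 P) <= d1 (source P) x }.

(* [u psi] is the solution for the drift psi, g the data at the final time. *)

Definition K {R : realType} (P : problem R)
    (u : (R * R -> R) -> R * R -> R -> R) (g : R * R -> R) (psi : R * R -> R) :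
    R * R -> R :=
  fun x => (source P x - dt (final_time P) (u psi) x (final_time P) + laplacian g x - Cp P * g x)
           / d1 g x.

Definition D_K {R : realType} (P : problem R) (g : R * R -> R) :
    set (R * R -> R) :=
  [set psi | Cspace 1 psi /\
     forall x, Omega x -> psi x <= (source P x + laplacian g x - Cp P * g x) / d1 g x].

(* Main.v *)
(** At the final time both functions satisfy the same elliptic equation as soon
    as division by d_{x1} g is legitimate, so everything rests on two facts.

    First, d_{x1} g > 0 on Omega.  The derivative v = d_{x1} u(.; q* ) solves
    v_t - Delta v + q* v_{x1} + (Cp + d_{x1} q* ) v = d_{x1} f >= 0, where
    Cp + d_{x1} q* > 0, and its lateral and initial data are nonnegative, with
    v = - b4 > 0 on l4.  Comparison with the explicit subsolution
    - b4 (exp (- a rho) - exp (- a)), rho = x1 + A (x2 - y0)^2 + (T - t) / T,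
    which is positive at (s0, y0, T) and at most 0 on the parabolic boundary away
    from l4, gives v > 0 at (s0, y0, T) without the strong maximum principle.

    Second, w = u(., T; q) - g solves - Delta w + q w_{x1} + Cp w = 0 with
    homogeneous mixed boundary conditions when q is a fixed point of K, and the
    maximum principle applied to w + eps (x1 - 1/2)^2 gives w = 0. *)
Require Import Defs.
From mathcomp Require Import all_boot all_order all_algebra.
From mathcomp Require Import all_classical all_reals all_analysis.
From mathcomp Require Import ring lra.
Set Implicit Arguments.
Unset Strict Implicit.
Unset Printing Implicit Defensive.
Import Order.TTheory GRing.Theory Num.Theory.
Import numFieldNormedType.Exports.
Local Open Scope classical_set_scope.
Local Open Scope ring_scope.

(** * Derivatives within a set *)

(** Relational form of [derive_in]: with the value named, the sum rules come straight from those for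
    limits, and one-sided derivatives at endpoints need no separate treatment. *)
Definition deriv_within {R : realType} (I : set R) (f : R -> R) (a l : R) : Prop :=
  (f s - f a) / (s - a) @[s --> within I a^'] --> l.

Section OneVariable.
Context {R : realType}.
Implicit Types (f g : R -> R) (I : set R) (a b l m e d s t x : R).

Lemma deriv_withinP I f a l :
  deriv_within I f a l <->
  forall e, 0 < e -> exists2 d, 0 < d & forall s, I s -> s != a ->
    `|s - a| < d -> `|(f s - f a) / (s - a) - l| < e.
Proof.
split=> [/cvgrPdist_lt H e e0|H].
  have := H e e0 => {}H.
  have {}H : \forall s \near a, s != a -> I s ->
      `|l - (f s - f a) / (s - a)| < e by exact: H.
  have /nbhs_ballP[d /= d0 dP] := H.
  exists d => // s Is sa sd; rewrite distrC; apply: dP => //.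
  by rewrite /ball /= distrC.
apply/cvgrPdist_lt => e e0; have [d d0 dP] := H e e0.
suff : \forall s \near a, s != a -> I s -> `|l - (f s - f a) / (s - a)| < e
  by [].
apply/nbhs_ballP; exists d => //= s; rewrite /ball /= distrC => sd sa Is.
by rewrite distrC; exact: dP.
Qed.

Lemma deriv_within_derive_in I f a :
  derivable_in I f a -> deriv_within I f a (derive_in I f a).
Proof. by []. Qed.

Lemma deriv_within_is_derive I f a l : I° a ->
  deriv_within I f a l -> is_derive a 1 f l.
Proof.
move=> Ia Hl; have := Hl; rewrite /deriv_within quotient_in_interior// => H.
have E : 'D_1 f a = l by rewrite -derive1E; apply: cvg_lim.
have D : derivable f a 1.
  exact: (iffLR (derivable_in_interior f Ia) (cvgP l Hl)).
by split.
Qed.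

Lemma derivable_in_is_derive I f a : I° a ->
  derivable_in I f a -> is_derive a 1 f (derive_in I f a).
Proof. by move=> Ia; exact: deriv_within_is_derive. Qed.

Lemma is_derive_derive_in I f a l : I° a ->
  is_derive a 1 f l -> derive_in I f a = l.
Proof. by move=> Ia [_ <-]; rewrite derive_in_interior// derive1E. Qed.

Lemma is_derive_deriv_within I f a l :
  is_derive a 1 f l -> deriv_within I f a l.
Proof.
move=> [Hd Hl].
have T' : ([set: R])° a by rewrite interiorT.
have : deriv_within setT f a l.
  rewrite -Hl -derive1E -(derive_in_interior f T').
  by apply/deriv_within_derive_in/(derivable_in_interior f T').
move/deriv_withinP => H; apply/deriv_withinP => e /H[d d0 dP].
by exists d => // s _; exact: dP.
Qed.

Lemma deriv_withinD I f g a l m : deriv_within I f a l ->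
  deriv_within I g a m -> deriv_within I (fun s => f s + g s) a (l + m).
Proof.
move=> Hf Hg; rewrite /deriv_within.
under eq_cvg do rewrite opprD addrACA mulrDl.
exact: cvgD.
Qed.

Lemma deriv_withinN I f a l : deriv_within I f a l ->
  deriv_within I (fun s => - f s) a (- l).
Proof.
move=> Hf; rewrite /deriv_within.
under eq_cvg do rewrite -opprD mulNr.
exact: cvgN.
Qed.

Lemma deriv_withinB I f g a l m : deriv_within I f a l ->
  deriv_within I g a m -> deriv_within I (fun s => f s - g s) a (l - m).
Proof. by move=> Hf Hg; apply: deriv_withinD => //; exact: deriv_withinN. Qed.

(** Difference quotients taken from the left of a minimum are nonpositive. The last hypothesis
    provides such quotients arbitrarily close to [a], which makes the lemma usable at a right
    endpoint such as the side x1 = 1 or the final time. *)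
Lemma deriv_within_min_left I f a l :
  deriv_within I f a l -> (forall s, I s -> f a <= f s) ->
  (forall d, 0 < d -> exists s, [/\ I s, s < a & a - d < s]) -> l <= 0.
Proof.
move=> /deriv_withinP H fmin left; rewrite leNgt; apply/negP => l0.
have [d d0 dP] := H l l0; have [s [Is sa das]] := left d d0.
have := dP s Is; rewrite lt_eqF// => /(_ isT).
rewrite ltr0_norm ?subr_lt0// ltr_norml => /(_ ltac:(lra)) /andP[+ _].
have : (f s - f a) / (s - a) <= 0.
  by rewrite ler_ndivrMr ?subr_lt0// mul0r subr_ge0 fmin.
lra.
Qed.

Lemma deriv_within_min_right I f a l :
  deriv_within I f a l -> (forall s, I s -> f a <= f s) ->
  (forall d, 0 < d -> exists s, [/\ I s, a < s & s < a + d]) -> 0 <= l.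
Proof.
move=> /deriv_withinP H fmin right; rewrite leNgt; apply/negP => l0.
have [d d0 dP] := H (- l) ltac:(lra); have [s [Is sa das]] := right d d0.
have := dP s Is; rewrite gt_eqF// => /(_ isT).
rewrite gtr0_norm ?subr_gt0// ltr_norml => /(_ ltac:(lra)) /andP[_ +].
have : 0 <= (f s - f a) / (s - a).
  by rewrite divr_ge0 ?subr_ge0 ?fmin// ltW.
lra.
Qed.

Lemma itvoo_left a b x d : a < x -> 0 < d -> x <= b ->
  exists s, [/\ a < s, s < b, s < x & x - d < s].
Proof.
move=> ax d0 xb; exists (Num.max ((a + x) / 2) (x - d / 2)).
by rewrite !lt_max !gt_max; split; lra.
Qed.

Lemma itvoo_right a b x d : x < b -> 0 < d -> a <= x ->
  exists s, [/\ a < s, s < b, x < s & s < x + d].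
Proof.
move=> ax d0 xb; exists (Num.min ((b + x) / 2) (x + d / 2)).
by rewrite !gt_min !lt_min; split; lra.
Qed.

Lemma interior_itv_cc a b x : a < x < b -> (`[a, b]%classic)° x.
Proof.
move=> xab; have : (`]a, b[%classic)° x.
  by apply/open_nbhs_nbhs; split => //=; rewrite in_itv.
by apply: interiorS => s /=; rewrite !in_itv/= => /andP[? ?]; rewrite !ltW.
Qed.

Lemma min_is_derive0 f a b x l : a < x < b -> is_derive x 1 f l ->
  (forall s, a < s < b -> f x <= f s) -> l = 0.
Proof.
move=> /andP[ax xb] /(is_derive_deriv_within `]a, b[) fl fmin.
have {}fmin s : `]a, b[%classic s -> f x <= f s by rewrite /= in_itv/=; exact: fmin.
apply/eqP; rewrite eq_le; apply/andP; split.
  apply: (deriv_within_min_left fl fmin) => d d0.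
  have [s [? ? ? ?]] := itvoo_left ax d0 (ltW xb).
  by exists s; split => //=; rewrite in_itv/=; apply/andP.
apply: (deriv_within_min_right fl fmin) => d d0.
have [s [? ? ? ?]] := itvoo_right xb d0 (ltW ax).
by exists s; split => //=; rewrite in_itv/=; apply/andP.
Qed.

Lemma is_derive_continuous f x l : is_derive x 1 f l -> {for x, continuous f}.
Proof. by move=> [fd _]; apply/differentiable_continuous/derivable1_diffP. Qed.

Lemma MVT_is_derive f f' s t : s < t ->
  (forall x, s <= x <= t -> is_derive x 1 f (f' x)) ->
  exists2 c, s < c < t & f t - f s = f' c * (t - s).
Proof.
move=> st fd.
have [x /[!in_itv] xab|x xab|c] := @MVT R f f' s t st.
- by apply: fd; move: xab => /= /andP[? ?]; rewrite !ltW.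
- apply/continuous_in_subspaceT: x xab => x; rewrite inE/= in_itv/= => /fd.
  exact: is_derive_continuous.
- by rewrite in_itv/= => ? ?; exists c.
Qed.

(** Since [f' x = 0], a negative [l] would make [f'] negative just to the right of [x], and the mean
    value theorem would give a value of [f] below the minimum. *)
Lemma min_is_derive2_ge0 f f' a b x l : a < x < b ->
  (forall s, a < s < b -> is_derive s 1 f (f' s)) -> is_derive x 1 f' l ->
  (forall s, a < s < b -> f x <= f s) -> 0 <= l.
Proof.
move=> xab fd f'd fmin; have f'0 := min_is_derive0 xab (fd x xab) fmin.
rewrite leNgt; apply/negP => l0; have /andP[ax xb] := xab.
have /(is_derive_deriv_within setT)/deriv_withinP := f'd.
move=> /(_ (- l) ltac:(lra))[d d0 dP].
have [s [as_ sb xs sd]] := itvoo_right xb d0 (ltW ax).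
have [|c /andP[xc cs]] := @MVT_is_derive f f' x s xs.
  by move=> y /andP[? ?]; apply: fd; apply/andP; split; lra.
move=> E; have := dP c I; rewrite gt_eqF// => /(_ isT).
rewrite gtr0_norm ?subr_gt0// ltr_norml f'0 subr0 => /(_ ltac:(lra)) /andP[_].
rewrite ltrBlDr addNr ltr_pdivrMr ?subr_gt0// mul0r => f'c.
have := fmin s ltac:(apply/andP; split; lra); nra.
Qed.

End OneVariable.

Lemma deriv_within_continuous {R : realType} (I : set R) (f : R -> R) (a l e : R) :
  deriv_within I f a l -> 0 < e ->
  exists2 d, 0 < d & forall s, I s -> `|s - a| < d -> `|f s - f a| < e.
Proof.
move=> /deriv_withinP/(_ 1 ltr01)[d d0 dP] e0.
have l1 : 0 < `|l| + 1 by have := normr_ge0 l; lra.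
(* Within [d] the quotient is less than 1 away from [l], so [f] has slope at most [|l| + 1] in
   absolute value as seen from [a]. *)
exists (Num.min d (e / (`|l| + 1))); first by rewrite lt_min d0 divr_gt0.
move=> s Is; rewrite lt_min => /andP[sd]; rewrite ltr_pdivlMr// => se.
have [->|sa] := eqVneq s a; first by rewrite subrr normr0.
have := dP s Is sa sd; set q := _ / _ => ql.
have -> : f s - f a = q * (s - a) by rewrite /q divfK// subr_eq0.
have : `|q| <= `|l| + 1.
  by have := ler_normD (q - l) l; rewrite subrK => ?; lra.
by move=> ?; rewrite normrM mulrC; apply: le_lt_trans se; rewrite ler_wpM2l.
Qed.

(** The segment lies in [I], so its inner points are interior to [I] and the derivative there is the
    ordinary one; at the two ends only continuity along the segment is required. *)
Lemma MVT_deriv_within {R : realType} (I : set R) (f f' : R -> R) (a b : R) :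
  a < b -> (forall x, a <= x <= b -> I x /\ deriv_within I f x (f' x)) ->
  exists2 c, a < c < b & f b - f a = f' c * (b - a).
Proof.
move=> ab fd.
have [x||c] := @MVT R f f' a b ab.
- rewrite in_itv/= => xab; have [|_] := fd x.
    by case/andP: xab => *; rewrite !ltW.
  apply: deriv_within_is_derive.
  apply: (@interiorS _ `[a, b]); last exact: interior_itv_cc.
  by move=> y /=; rewrite in_itv/= => /fd[].
- apply/subspace_continuousP => x; rewrite /= in_itv/= => /fd[_ H].
  apply/cvgrPdist_lt => e e0.
  have [d d0 dP] := deriv_within_continuous H e0.
  suff : \forall y \near x, `[a, b]%classic y -> `|f x - f y| < e by [].
  apply/nbhs_ballP; exists d => //= y; rewrite /ball/= distrC => yd.
  by rewrite in_itv/= => /fd[Iy _]; rewrite distrC; exact: dP.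
- by rewrite in_itv/= => ? ?; exists c.
Qed.

Lemma MVT_is_derive_dist {R : realType} (f f' : R -> R) (s t : R) : s != t ->
  (forall x, `|x - s| <= `|t - s| -> is_derive x 1 f (f' x)) ->
  exists2 c, `|c - s| < `|t - s| & f t - f s = f' c * (t - s).
Proof.
move=> st fd; have [lt_st|lt_ts|/eqP] := ltgtP s t; last by rewrite (negPf st).
  have Nst : `|t - s| = t - s by rewrite gtr0_norm// subr_gt0.
  have [x|c /andP[sc ct] E] := @MVT_is_derive _ f f' s t lt_st.
    by move=> /andP[? ?]; apply: fd; rewrite Nst ler_norml; apply/andP; split; lra.
  by exists c => //; rewrite Nst ltr_norml; apply/andP; split; lra.
have Nst : `|t - s| = s - t by rewrite ltr0_norm ?subr_lt0// opprB.
have [x|c /andP[sc ct] E] := @MVT_is_derive _ f f' t s lt_ts.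
  by move=> /andP[? ?]; apply: fd; rewrite Nst ler_norml; apply/andP; split; lra.
exists c; first by rewrite Nst ltr_norml; apply/andP; split; lra.
by rewrite -[_ - f s]opprB E -mulrN opprB.
Qed.

(* Only left neighbourhoods of t0 are used, so that t0 may be the final time. *)
Lemma is_derive_mixed {R : realType} (F F1 F12 : R -> R -> R) (G : R -> R)
    (I : set R) (s0 t0 d L : R) :
  0 < d -> (forall t, t0 - d < t <= t0 -> I t) ->
  (forall s t, `|s - s0| < d -> t0 - d < t <= t0 ->
     is_derive s 1 (F^~ t) (F1 s t)) ->
  (forall s t, `|s - s0| < d -> t0 - d < t <= t0 ->
     deriv_within I (F1 s) t (F12 s t)) ->
  (forall s, `|s - s0| < d -> deriv_within I (F s) t0 (G s)) ->
  (forall e, 0 < e -> exists2 r, 0 < r & forall s t, `|s - s0| < r ->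
     `|t - t0| < r -> t <= t0 -> `|F12 s t - L| < e) ->
  is_derive s0 1 G L.
Proof.
move=> d0 Id F1P F12P GP cvL.
apply: (@deriv_within_is_derive _ setT); first by rewrite interiorT.
apply/deriv_withinP => e e0.
have [r r0 rP] := cvL (e / 2) ltac:(lra).
exists (Num.min r d) => [|s _ ss0]; first by rewrite lt_min r0.
rewrite lt_min => /andP[sr sd]; set h := s - s0.
have h0 : 0 < `|h| by rewrite normr_gt0 subr_eq0.
(* Budget: each of the two time quotients is off by less than [e |h| / 8], which costs [e / 4] after
   division by [h]; the oscillation of [F12] costs [e / 2]. *)
have eh0 : 0 < e * `|h| / 8 by rewrite divr_gt0// mulr_gt0.
have /deriv_withinP/(_ _ eh0)[d1 d10 d1P] := GP s sd.
have s0d : `|s0 - s0| < d by rewrite subrr normr0.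
have /deriv_withinP/(_ _ eh0)[d2 d20 d2P] := GP s0 s0d.
pose m := Num.min (Num.min d1 d2) (Num.min r d).
have [m0 [md1 md2 mr md]] : 0 < m /\ [/\ m <= d1, m <= d2, m <= r & m <= d].
  by rewrite !lt_min d10 d20 r0 !ge_min !lexx !orbT.
have t01 : t0 - 1 < t0 by rewrite ltrBlDr ltrDl.
have [t [_ _ tlt0 tm]] := itvoo_left t01 m0 (lexx t0).
have tt0 : t != t0 by rewrite lt_eqF.
have dist y : t <= y <= t0 -> `|y - t0| < m.
  by rewrite ltr_norml; clear -tm m0 => /andP[? ?]; apply/andP; split; lra.
have left y : t <= y <= t0 -> t0 - d < y <= t0.
  by clear -tm md => /andP[? ?]; apply/andP; split; lra.
have tle : t <= t <= t0 by rewrite lexx ltW.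
have t0le : t <= t0 <= t0 by rewrite lexx ltW.
have It := Id t (left t tle).
(* The mixed second difference of [F] is evaluated by two mean value theorems, first in the space
   variable and then in time, and becomes [F12] at an intermediate point times both increments. *)
have [|x|x] := @MVT_is_derive_dist _ (fun x => F x t - F x t0)
  (fun x => F1 x t - F1 x t0) s0 s.
- by rewrite eq_sym.
- by rewrite -/h => /le_lt_trans/(_ sd) xd; apply: is_deriveB; apply: F1P => //; exact: left.
rewrite -/h => xs xE.
have [||y /andP[ty yt0] yE] := @MVT_deriv_within _ I (F1 x) (F12 x) t t0.
- exact: tlt0.
- move=> y /left ly; split; first exact: Id.
  by apply: F12P ly; exact: lt_trans sd.
have yle : t <= y <= t0 by rewrite !ltW.
have F12L := rP x y (lt_trans xs sr) (lt_le_trans (dist y yle) mr) (ltW yt0).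
have := d1P t It tt0 (lt_le_trans (dist t tle) md1).
have := d2P t It tt0 (lt_le_trans (dist t tle) md2).
set A := (_ / _) => B2; set B := (_ / _) => B1.
have E : B - A = F12 x y * h.
  rewrite /A /B -mulrBl; apply: (@mulIf _ (t - t0)); first by rewrite subr_eq0.
  rewrite divfK ?subr_eq0//.
  have -> : F s t - F s t0 - (F s0 t - F s0 t0) = (F1 x t - F1 x t0) * h by [].
  by rewrite -[F1 x t - _]opprB yE; ring.
have -> : (G s - G s0) / h - L =
    (F12 x y - L) + ((G s - B) - (G s0 - A)) / h.
  have -> : G s - B - (G s0 - A) = G s - G s0 - F12 x y * h by rewrite -E; ring.
  by field; rewrite -normr_gt0.
apply: le_lt_trans (ler_normD _ _) _.
suff : `|(G s - B - (G s0 - A)) / h| <= e / 4 by clear -F12L e0; lra.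
rewrite normrM normfV ler_pdivrMr//.
apply: le_trans (ler_normB _ _) _.
by move: B1 B2; rewrite ![`|_ - G _|]distrC; clear; lra.
Qed.

(** * The unit square *)

Section Box.
Context {R : realType}.

Lemma continuous_onP (A : set ((R * R) * R)) (W : R * R -> R -> R) s y t :
  continuous_on A W -> A ((s, y), t) ->
  forall e, 0 < e -> exists2 d, 0 < d & forall s' y' t',
    `|s' - s| < d -> `|y' - y| < d -> `|t' - t| < d -> A ((s', y'), t') ->
    `|W (s', y') t' - W (s, y) t| < e.
Proof.
move=> /subspace_continuousP cW Ax e e0.
have /cvgrPdist_lt/(_ e e0) H := cW _ Ax.
have {}H : \forall z \near ((s, y), t), A z ->
   `|W (s, y) t - W z.1 z.2| < e by exact: H.
have /nbhs_ballP[d /= d0 dP] := H.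
exists d => // s' y' t' ds dy dt' A'; rewrite distrC.
by apply: (dP ((s', y'), t')) => //; split=> //=; [split=> /=|]; rewrite /ball/= distrC.
Qed.

Lemma continuous_onS (A B : set ((R * R) * R)) (W : R * R -> R -> R) :
  A `<=` B -> continuous_on B W -> continuous_on A W.
Proof. exact: continuous_subspaceW. Qed.

Lemma unit_interval_dense (a d : R) : 0 <= a <= 1 -> 0 < d ->
  exists2 s, 0 < s < 1 & `|s - a| < d.
Proof.
move=> /andP[a0 a1] d0; pose e := Num.min (1 / 2) (d / 2).
have [e0 [e1 e2]] : 0 < e /\ e <= 1 / 2 /\ e <= d / 2.
  by rewrite /e lt_min !ge_min !lexx orbT; split; [apply/andP; split; lra|].
(* Moving a fraction [e] of the way towards the midpoint enters the open interval from either
   endpoint. *)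
exists (a + e * (1 / 2 - a)); first by apply/andP; split; nra.
by rewrite addrAC subrr add0r ltr_norml; apply/andP; split; nra.
Qed.

(** Stands in for [closure Omega]: compactness and the splitting into sides are direct for a product
    of segments, and continuity on the closure restricts to it by [square_closure]. *)
Definition square : set (R * R) := `[0, 1] `*` `[0, 1].

Lemma squareP (s y : R) : square (s, y) <-> 0 <= s <= 1 /\ 0 <= y <= 1.
Proof. by rewrite /square /= !in_itv. Qed.

Lemma OmegaP (s y : R) : Omega (s, y) <-> 0 < s < 1 /\ 0 < y < 1.
Proof. by rewrite /Omega /= !in_itv. Qed.

Lemma square_closure : square `<=` closure (@Omega R).
Proof.
move=> [s y] /squareP[s01 y01] B /nbhs_ballP[d /= d0 dB].
have [s' s'01 s'd] := unit_interval_dense s01 d0.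
have [y' y'01 y'd] := unit_interval_dense y01 d0.
exists (s', y'); split; first exact/OmegaP.
by apply: dB; split => /=; rewrite /ball/= distrC.
Qed.

Lemma Omega_square : @Omega R `<=` square.
Proof.
by move=> [s y] /OmegaP[/andP[? ?] /andP[? ?]]; apply/squareP; rewrite !ltW.
Qed.

Lemma compact_square : compact square.
Proof. by apply: compact_setX; apply: segment_compact. Qed.

Lemma square_cases (s y : R) : square (s, y) ->
  Omega (s, y) \/ l1 (s, y) \/ l2 (s, y) \/ l3 (s, y) \/ l4 (s, y).
Proof.
move=> /squareP[s01 /andP[y0 y1]]; have /andP[s0 s1] := s01.
(* The horizontal sides are tested first because the corners belong to them. *)
have [y0E|y_0] := eqVneq y 0.
  by right; left; rewrite /l1 /= in_itv.
have [y1E|y_1] := eqVneq y 1.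
  by do 3 right; left; rewrite /l3 /= in_itv.
have y01 : 0 < y < 1 by rewrite !lt_neqAle y0 y1 y_1 eq_sym y_0.
have [s1E|s_1] := eqVneq s 1.
  by do 2 right; left; rewrite /l2 /= in_itv.
have [s0E|s_0] := eqVneq s 0.
  by do 4 right; rewrite /l4 /= in_itv.
by left; apply/OmegaP; split=> //; rewrite !lt_neqAle s0 s1 s_1 eq_sym s_0.
Qed.
End Box.

(** * The equation for the derivative in x1 *)

Section Interior.
Context {R : realType}.
Implicit Types (phi psi : R * R -> R) (s y e : R) (x : R * R).

Lemma within_continuousP (A : set (R * R)) phi s y :
  {within A, continuous phi} -> A (s, y) ->
  forall e, 0 < e -> exists2 d, 0 < d & forall s' y',
    `|s' - s| < d -> `|y' - y| < d -> A (s', y') ->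
    `|phi (s', y') - phi (s, y)| < e.
Proof.
move=> /subspace_continuousP cphi Ax e e0.
have /cvgrPdist_lt/(_ e e0) H := cphi _ Ax.
have {}H : \forall z \near (s, y), A z -> `|phi (s, y) - phi z| < e by exact: H.
have /nbhs_ballP[d /= d0 dP] := H.
exists d => // s' y' ds dy A'; rewrite distrC.
by apply: (dP (s', y')) => //; split=> /=; rewrite /ball/= distrC.
Qed.

Lemma derivable1_is_derive phi s y : Omega (s, y) -> derivable1 phi (s, y) ->
  is_derive s 1 (fun r => phi (r, y)) (d1 phi (s, y)).
Proof.
by move=> /OmegaP[s01 _]; apply: derivable_in_is_derive; exact: interior_itv_cc.
Qed.

Lemma derivable2_is_derive phi s y : Omega (s, y) -> derivable2 phi (s, y) ->
  is_derive y 1 (fun r => phi (s, r)) (d2 phi (s, y)).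
Proof.
by move=> /OmegaP[_ y01]; apply: derivable_in_is_derive; exact: interior_itv_cc.
Qed.

Lemma derivable1_deriv_within phi s y : derivable1 phi (s, y) ->
  deriv_within `[0, 1] (fun r => phi (r, y)) s (d1 phi (s, y)).
Proof. by []. Qed.

Lemma derivable2_deriv_within phi s y : derivable2 phi (s, y) ->
  deriv_within `[0, 1] (fun r => phi (s, r)) y (d2 phi (s, y)).
Proof. by []. Qed.

Lemma is_derive_d1 phi s y l : Omega (s, y) ->
  is_derive s 1 (fun r => phi (r, y)) l -> d1 phi (s, y) = l.
Proof.
by move=> /OmegaP[s01 _]; apply: is_derive_derive_in; exact: interior_itv_cc.
Qed.

Lemma Omega_near s y : Omega (s, y) ->
  exists2 d, 0 < d & forall s' y', `|s' - s| < d -> `|y' - y| < d ->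
    Omega (s', y').
Proof.
move=> /OmegaP[/andP[s0 s1] /andP[y0 y1]].
exists (Num.min (Num.min s (1 - s)) (Num.min y (1 - y))).
  by rewrite !lt_min !subr_gt0 s0 s1 y0.
move=> s' y'; rewrite !lt_min !ltr_norml.
move=> /andP[/andP[/andP[? ?] /andP[? ?]] _] /andP[_ /andP[/andP[? ?] /andP[? ?]]].
by apply/OmegaP; split; apply/andP; split; lra.
Qed.

(** Interchange of the two space derivatives: [is_derive_mixed] with x2 in the role of time. *)
Lemma is_derive_d2 phi psi s y : Omega (s, y) ->
  (forall s y, Omega (s, y) -> is_derive s 1 (fun r => phi (r, y)) (psi (s, y))) ->
  (forall x, Omega x -> derivable2 phi x) ->
  (forall x, Omega x -> derivable2 psi x) ->
  {within Omega, continuous (d2 psi)} ->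
  is_derive s 1 (fun r => d2 phi (r, y)) (d2 psi (s, y)).
Proof.
move=> Osy phi1 phi2 psi2 cpsi.
have [d d0 dP] := Omega_near Osy; have /OmegaP[_ /andP[y0 y1]] := Osy.
have Oy s' : `|s' - s| < d -> Omega (s', y).
  by move=> ?; apply: dP => //; rewrite subrr normr0.
have Ot s' t : `|s' - s| < d -> y - d < t <= y -> Omega (s', t).
  by move=> ? /andP[? ?]; apply: dP => //; rewrite ltr_norml; apply/andP; split; lra.
apply: (@is_derive_mixed _ (fun s t => phi (s, t)) (fun s t => psi (s, t))
  (fun s t => d2 psi (s, t)) _ `[0, 1] s y d) => //.
- have ss : `|s - s| < d by rewrite subrr normr0.
  by move=> t /(Ot _ _ ss)/Omega_square/squareP[_]; rewrite /= in_itv.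
- by move=> s' t ? ?; apply: phi1; exact: Ot.
- by move=> s' t ? ?; apply/derivable2_deriv_within/psi2/Ot.
- by move=> s' /Oy/phi2/derivable2_deriv_within.
- move=> e e0; have [r r0 rP] := within_continuousP cpsi Osy e0.
  exists (Num.min r d); first by rewrite lt_min r0.
  move=> s' t; rewrite !lt_min => /andP[? ?] /andP[? ?] _.
  by apply: rP => //; exact: dP.
Qed.

Lemma Ck2_is_derive phi s y : Ck 2 phi -> Omega (s, y) ->
  [/\ is_derive s 1 (fun r => phi (r, y)) (d1 phi (s, y)),
      is_derive s 1 (fun r => d1 phi (r, y)) (d1 (d1 phi) (s, y)),
      is_derive y 1 (fun r => phi (s, r)) (d2 phi (s, y)) &
      is_derive y 1 (fun r => d2 phi (s, r)) (d2 (d2 phi) (s, y))].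
Proof.
move=> [_ [H [_ [H1 _ _]] [_ [H2 _ _]]]] Osy; split.
- by apply: derivable1_is_derive => //; exact: (H _ Osy).1.
- by apply: derivable1_is_derive => //; exact: (H1 _ Osy).1.
- by apply: derivable2_is_derive => //; exact: (H _ Osy).2.
- by apply: derivable2_is_derive => //; exact: (H2 _ Osy).2.
Qed.

(** Two interchanges: the pair [phi], [d1 phi] yields that [d2 (d1 phi)] is the x1-derivative of
    [d2 phi], and this new pair is interchanged again. *)
Lemma is_derive_d2d2 phi s y : Ck 2 phi -> Ck 2 (d1 phi) -> Omega (s, y) ->
  is_derive s 1 (fun r => d2 (d2 phi) (r, y)) (d2 (d2 (d1 phi)) (s, y)).
Proof.
move=> [_ [H _ [_ [H2 _ _]]]] [_ [K _ [C2 [K2 _ [C22 _]]]]] Osy.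
apply: is_derive_d2 => //.
- move=> s' y' Osy'; apply: is_derive_d2 => //.
  + by move=> s'' y'' O''; apply: derivable1_is_derive => //; exact: (H _ O'').1.
  + by move=> x /H[].
  + by move=> x /K[].
- by move=> x /H2[].
- by move=> x /K2[].
Qed.

Lemma is_derive_dt (T : R) (U : R * R -> R -> R) s y t :
  C21 T U -> C21 T (dx1 U) -> Omega (s, y) -> 0 < t <= T ->
  is_derive s 1 (fun r => dt T U (r, y) t) (dt T (dx1 U) (s, y) t).
Proof.
move=> CU CU1 Osy /andP[t0 tT]; have [d d0 dP] := Omega_near Osy.
have Oy s' : `|s' - s| < d -> Omega (s', y).
  by move=> ?; apply: dP => //; rewrite subrr normr0.
(* The radius [Num.min d t] keeps the points in [Omega] and the times positive. *)
apply: (@is_derive_mixed _ (fun r u => U (r, y) u) (fun r u => dx1 U (r, y) u)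
  (fun r u => dt T (dx1 U) (r, y) u) _ `[0, T] s t (Num.min d t)).
- by rewrite lt_min d0.
- move=> u; rewrite /= in_itv/= ltrBlDr -ltrBlDl lt_min => /andP[/andP[? ?] ?].
  by apply/andP; split; lra.
- move=> s' u; rewrite lt_min ltrBlDr -ltrBlDl lt_min.
  move=> /andP[/Oy Os' _] /andP[/andP[_ ?] ?]; apply: derivable1_is_derive => //.
  have /(C21_space CU)[_ [H _ _]] : 0 < u <= T by apply/andP; split; lra.
  exact: (H _ Os').1.
- move=> s' u; rewrite lt_min ltrBlDr -ltrBlDl lt_min.
  move=> /andP[/Oy Os' _] /andP[/andP[_ ?] ?]; apply: (C21_time CU1) => //.
  by apply/andP; split; lra.
- move=> s'; rewrite lt_min => /andP[/Oy Os' _]; apply: (C21_time CU) => //.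
  exact/andP.
- move=> e e0.
  have [|r r0 rP] := continuous_onP (s := s) (y := y) (t := t) (C21_cont_t CU1) _ e0.
    by split => //=; rewrite in_itv/= t0.
  exists (Num.min r (Num.min d t)); first by rewrite !lt_min r0 d0.
  move=> s' u; rewrite !lt_min => /andP[? /andP[/Oy ? _]] /andP[? /andP[_]].
  rewrite ltr_norml => /andP[? _] ?.
  apply: rP => //; first by rewrite subrr normr0.
  by split => //=; rewrite in_itv/=; apply/andP; split; lra.
Qed.

(** The product rule on the drift term produces [d1 psi * dx1 U], which is absorbed into the
    zero-order coefficient. *)
Lemma differentiated_equation (P : problem R) psi (U : R * R -> R -> R) x t :
  is_solution P psi U -> Cspace 1 psi ->
  Omega x -> 0 < t <= final_time P ->
  dt (final_time P) (dx1 U) x t - laplacian (dx1 U ^~ t) x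
    + psi x * d1 (dx1 U ^~ t) x + (Cp P + d1 psi x) * dx1 U x t
  = d1 (source P) x.
Proof.
case: x => s y sol [[_ [psi1 _ _]] _] Osy tT.
have reg := sol_regular sol.
have C2U := C21_space (regular_C21 reg) tT.
have C2V := C21_space (regular_C21_1 reg) tT.
have [U1 _ _ _] := Ck2_is_derive C2U Osy.
have [V1 V11 _ _] := Ck2_is_derive C2V Osy.
have U221 := is_derive_d2d2 C2U C2V Osy.
have Ut1 := is_derive_dt (regular_C21 reg) (regular_C21_1 reg) Osy tT.
have psi1' := derivable1_is_derive Osy (psi1 _ Osy).1.
pose T := final_time P.
pose lhs r := dt T U (r, y) t - laplacian (U ^~ t) (r, y)
  + psi (r, y) * d1 (U^~ t) (r, y) + Cp P * U (r, y) t.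
have lhs1 : is_derive s 1 lhs (dt T (dx1 U) (s, y) t - laplacian (dx1 U ^~ t) (s, y)
    + psi (s, y) * d1 (dx1 U ^~ t) (s, y) + (Cp P + d1 psi (s, y)) * dx1 U (s, y) t).
  have H : is_derive s 1 lhs _ := is_deriveD (is_deriveD (is_deriveB Ut1 (is_deriveD V11 U221))
    (is_deriveM psi1' V1)) (is_deriveZ (Cp P) U1).
  apply: (is_derive_eq H).
  by rewrite /laplacian /GRing.scale/= /dx1; ring.
(* By the equation, [lhs] coincides with the source on a horizontal neighbourhood of the point, so
   the source inherits its derivative. *)
apply/esym/(is_derive_d1 Osy).
apply: near_eq_is_derive lhs1; apply/nbhs_ballP.
have [d d0 dP] := Omega_near Osy; exists d => // r; rewrite /ball/= distrC => sr.
by apply: (sol_eq sol) => //; apply: dP => //; rewrite subrr normr0.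
Qed.

End Interior.

(** * Locality of the derivatives and bounds from the C^j norms *)

Section Locality.
Context {R : realType}.
Implicit Types (phi psi : R * R -> R) (s y : R) (x : R * R).

Lemma eq_derive_in (I : set R) (f g : R -> R) (a : R) : I a ->
  (forall r, I r -> f r = g r) -> derive_in I f a = derive_in I g a.
Proof.
move=> Ia fg; rewrite /derive_in; congr (lim _).
apply/funext => S; apply/propext; split=> HS.
  suff : \forall s \near a, s != a -> I s -> S ((g s - g a) / (s - a)) by [].
  have {}HS : \forall s \near a, s != a -> I s -> S ((f s - f a) / (s - a)).
    exact: HS.
  by apply: filterS HS => r H ra Ir; rewrite -!fg//; exact: H.
suff : \forall s \near a, s != a -> I s -> S ((f s - f a) / (s - a)) by [].
have {}HS : \forall s \near a, s != a -> I s -> S ((g s - g a) / (s - a)).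
  exact: HS.
by apply: filterS HS => r H ra Ir; rewrite !fg//; exact: H.
Qed.

(** Agreement is known on the open square only, hence the passage to the interior derivative, for
    which a neighbourhood of the point is enough. *)
Lemma eq_d1 phi psi : (forall x, Omega x -> phi x = psi x) ->
  forall x, Omega x -> d1 phi x = d1 psi x.
Proof.
move=> E [s y] Osy; have /OmegaP[s01 _] := Osy.
rewrite /d1 !derive_in_interior ?derive1E; try exact: interior_itv_cc.
apply: near_eq_derive; apply/nbhs_ballP.
have [d d0 dP] := Omega_near Osy; exists d => // r; rewrite /ball/= distrC => sr.
by apply: E; apply: dP => //; rewrite subrr normr0.
Qed.

Lemma eq_d2 phi psi : (forall x, Omega x -> phi x = psi x) ->
  forall x, Omega x -> d2 phi x = d2 psi x.
Proof.
move=> E [s y] Osy; have /OmegaP[_ y01] := Osy.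
rewrite /d2 !derive_in_interior ?derive1E; try exact: interior_itv_cc.
apply: near_eq_derive; apply/nbhs_ballP.
have [d d0 dP] := Omega_near Osy; exists d => // r; rewrite /ball/= distrC => yr.
by apply: E; apply: dP => //; rewrite subrr normr0.
Qed.

Lemma eq_laplacian phi psi : (forall x, Omega x -> phi x = psi x) ->
  forall x, Omega x -> laplacian phi x = laplacian psi x.
Proof.
move=> E x Ox.
by rewrite /laplacian (eq_d1 (eq_d1 E) Ox) (eq_d2 (eq_d2 E) Ox).
Qed.

Lemma le_Cnorm (j a b : nat) phi x : (a + b <= j)%N -> Omega x ->
  (`|iter a d1 (iter b d2 phi) x|%:E <= Cnorm j phi)%E.
Proof.
move=> abj Ox.
have aj : (a < j.+1)%N by rewrite ltnS (leq_trans _ abj)// leq_addr.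
have bj : (b < j.+1)%N by rewrite ltnS (leq_trans _ abj)// leq_addl.
have sup_ge a' b' : (`|iter a' d1 (iter b' d2 phi) x|%:E <=
    ereal_sup [set (`|iter a' d1 (iter b' d2 phi) x|%:E) | x in Omega])%E.
  by apply: ereal_sup_ubound; exists x.
(* The point [x] matters here: the supremum over an empty set would be minus infinity. *)
have sup_ge0 a' b' : (0 <=
    ereal_sup [set (`|iter a' d1 (iter b' d2 phi) x|%:E) | x in Omega])%E.
  by apply: le_trans (sup_ge a' b'); rewrite lee_fin.
rewrite /Cnorm (bigD1 (Ordinal aj))//= (bigD1 (Ordinal bj))//= -addeA.
apply: le_trans (sup_ge a b) _; apply: leeDl.
by apply: adde_ge0; apply: sume_ge0 => // i _; apply: sume_ge0.
Qed.

Lemma fine_C0_ge0 (P : problem R) : 0 <= fine (C0 P).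
Proof.
apply: fine_ge0; rewrite /C0; elim/big_rec: _ => // i m _ m0.
by rewrite le_max m0 orbT.
Qed.

End Locality.

(** * Comparison principles *)

Section Comparison.
Context {R : realType}.

Lemma is_derive_quadratic (a c x : R) :
  is_derive x 1 (fun r => a * (r - c) ^+ 2) (2 * a * (x - c)).
Proof.
have H : is_derive x 1 (fun r => a * (r - c) ^+ 2) _ :=
  is_deriveZ a (is_deriveX 2 (is_deriveB (is_derive_id x 1)
    (is_derive_cst c x 1))).
apply: (is_derive_eq H).
by rewrite /GRing.scale/= ?fctE/=; ring.
Qed.

Lemma is_derive_linear (a c x : R) : is_derive x 1 (fun r => a * (r - c)) a.
Proof.
have H : is_derive x 1 (fun r => a * (r - c)) _ :=
  is_deriveZ a (is_deriveB (is_derive_id x 1) (is_derive_cst c x 1)).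
by apply: (is_derive_eq H); rewrite /GRing.scale/= subr0 mulr1.
Qed.

Lemma is_derive_expR_comp (h : R -> R) (x l : R) : is_derive x 1 h l ->
  is_derive x 1 (fun r => expR (h r)) (expR (h x) * l).
Proof.
move=> hl; have H := @is_derive1_comp _ expR h x _ _ (is_derive_expR (h x)) hl.
by apply: is_derive_eq H _; rewrite mulrC.
Qed.

(** A weak maximum principle for w = phi1 - phi2. The hypotheses are symmetric in the two functions,
    so a second application with the roles exchanged yields equality. *)
Lemma elliptic_comparison (C N : R) (b phi1 phi2 : R * R -> R) :
  0 < C -> (forall x, Omega x -> `|b x| <= N) ->
  Ck 2 phi1 -> Ck 2 phi2 ->
  {within square, continuous phi1} -> {within square, continuous phi2} ->
  (forall x, l1 x \/ l3 x -> phi1 x = phi2 x) ->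
  (forall x, l2 x \/ l4 x -> [/\ derivable1 phi1 x, derivable1 phi2 x &
     d1 phi1 x = d1 phi2 x]) ->
  (forall x, Omega x ->
     laplacian phi1 x - b x * d1 phi1 x - C * phi1 x
     = laplacian phi2 x - b x * d1 phi2 x - C * phi2 x) ->
  forall x, Omega x -> phi2 x <= phi1 x.
Proof.
move=> C0 bN C1 C2 c1 c2 dirichlet neumann eqn x0 Ox0.
rewrite leNgt; apply/negP => neg.
have N0 : 0 <= N by apply: le_trans (bN _ Ox0).
(* Chosen so that [C * K = C + 2 + N]. At an interior minimum of [v] the equation gives C w >= - (2
   + N) eps, while [w0] gives C w <= - 2 eps C K + C eps / 4, which is smaller. On the Dirichlet
   sides, where w = 0, [K >= 1] contradicts [w0]. *)
pose K := 1 + (2 + N) / C.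
have K1 : 1 <= K by rewrite /K lerDl divr_ge0 ?addr_ge0// ltW.
pose eps := (phi2 x0 - phi1 x0) / (2 * K).
have eps0 : 0 < eps by rewrite divr_gt0 ?subr_gt0//; lra.
have epsK : eps * K = (phi2 x0 - phi1 x0) / 2 by rewrite /eps; field; lra.
(* The perturbation has positive outward derivative on l2 and l4, so that the
   minimum of v is not attained there. *)
pose v x := phi1 x - phi2 x + eps * (x.1 - 1 / 2) ^+ 2.
have cv : {within square, continuous v}.
  move=> z; apply: cvgD; first by apply: cvgB; [exact: c1|exact: c2].
  have : {within square, continuous
      (fun z : R * R => eps * (z.1 - 1 / 2) ^+ 2)}.
    apply: continuous_subspaceT => u.
    apply: cvgM; first exact: cvg_cst.
    rewrite expr2; apply: cvgM; apply: cvgB; by [exact: cvg_fst|exact: cvg_cst].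
  exact.
have sq0 : @square R !=set0 by exists x0; exact: Omega_square.
have [[s y]] := compact_EVT_min sq0 compact_square cv.
rewrite inE => sy vmin.
have {}vmin (s' y' : R) : 0 <= s' <= 1 -> 0 <= y' <= 1 -> v (s, y) <= v (s', y').
  by move=> ? ?; apply: vmin; rewrite inE; exact/squareP.
have /squareP[s01 y01] := sy.
(* At [x0] the difference equals - 2 eps K and the perturbation is at most eps / 4. *)
have w0 : phi1 (s, y) - phi2 (s, y) <= - (2 * (eps * K)) + eps / 4.
  have xE := surjective_pairing x0.
  have : square (x0.1, x0.2) by rewrite -xE; exact: Omega_square.
  case/squareP=> s01' y01'.
  have := vmin _ _ s01' y01'; rewrite -xE /v /= epsK => {}vmin.
  have : 0 <= (s - 1 / 2) ^+ 2 by exact: sqr_ge0.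
  have : (x0.1 - 1 / 2) ^+ 2 <= 1 / 4.
    by rewrite expr2; case/andP: s01' => *; nra.
  by clear -vmin eps0; nra.
have epsK' : eps <= eps * K by rewrite ler_peMr// ltW.
(* The Neumann data cancel, so on l2 and l4 the x1-derivative of [v] is that of the perturbation
   alone. *)
have bdry (e : R) : is_derive s 1 (fun r => eps * (r - 1 / 2) ^+ 2) e ->
    l2 (s, y) \/ l4 (s, y) ->
    deriv_within `[0, 1] (fun r => v (r, y)) s e.
  move=> He /neumann[D1 D2 E].
  have := deriv_withinB (derivable1_deriv_within D1) (derivable1_deriv_within D2).
  rewrite E subrr => /deriv_withinD/(_ (is_derive_deriv_within `[0, 1] He)).
  by rewrite add0r.
have He := is_derive_quadratic eps (1 / 2) s.
have [Osy|[L1|[L2|[L3|L4]]]] := square_cases sy.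
- have /OmegaP[s01' y01'] := Osy.
  have vmin1 (r : R) : 0 < r < 1 -> v (s, y) <= v (r, y).
    by move=> /andP[? ?]; apply: vmin => //; rewrite !ltW.
  have vmin2 (r : R) : 0 < r < 1 -> v (s, y) <= v (s, r).
    by move=> /andP[? ?]; apply: vmin => //; rewrite !ltW.
  have v1 (r : R) : 0 < r < 1 -> is_derive r 1 (fun r => v (r, y))
      (d1 phi1 (r, y) - d1 phi2 (r, y) + 2 * eps * (r - 1 / 2)).
    move=> r01; have Ory : Omega (r, y) by exact/OmegaP.
    have [A _ _ _] := Ck2_is_derive C1 Ory; have [B _ _ _] := Ck2_is_derive C2 Ory.
    exact: (is_deriveD (is_deriveB A B) (is_derive_quadratic eps (1 / 2) r)).
  have v2 (r : R) : 0 < r < 1 -> is_derive r 1 (fun r => v (s, r))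
      (d2 phi1 (s, r) - d2 phi2 (s, r)).
    move=> r01; have Osr : Omega (s, r) by exact/OmegaP.
    have [_ _ A _] := Ck2_is_derive C1 Osr; have [_ _ B _] := Ck2_is_derive C2 Osr.
    have H := is_deriveD (is_deriveB A B)
      (is_derive_cst (eps * (s - 1 / 2) ^+ 2) r 1).
    by apply: (is_derive_eq H); rewrite addr0.
  have [_ A11 _ A22] := Ck2_is_derive C1 Osy.
  have [_ B11 _ B22] := Ck2_is_derive C2 Osy.
  have v11 := is_deriveD (is_deriveB A11 B11)
    (is_derive_linear (2 * eps) (1 / 2) s).
  have v22 := is_deriveB A22 B22.
  have w1 := min_is_derive0 s01' (v1 s s01') vmin1.
  have w11 : 0 <= d1 (d1 phi1) (s, y) - d1 (d1 phi2) (s, y) + 2 * eps.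
    exact: (min_is_derive2_ge0 s01' v1 v11 vmin1).
  have w22 := min_is_derive2_ge0 y01' v2 v22 vmin2.
  have := eqn _ Osy; rewrite /laplacian => E.
  have bw : b (s, y) * (d1 phi1 (s, y) - d1 phi2 (s, y)) <= N * eps.
    apply: le_trans (ler_norm _) _; rewrite normrM; apply: ler_pM => //.
      exact: bN.
    have -> : d1 phi1 (s, y) - d1 phi2 (s, y) = - (2 * eps * (s - 1 / 2)).
      by apply/eqP; rewrite -addr_eq0 w1.
    case/andP: s01' => ? ?.
    by rewrite normrN ler_norml; apply/andP; clear -eps0 s01; split; nra.
  have Cw : - ((2 + N) * eps) <= C * (phi1 (s, y) - phi2 (s, y)).
    by clear -E bw w11 w22; lra.
  have CK : C * K = C + 2 + N by rewrite /K; field; rewrite gt_eqF.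
  have := ler_wpM2l (ltW C0) w0.
  have -> : C * (- (2 * (eps * K)) + eps / 4) = - (2 * eps * (C * K)) + C * eps / 4.
    by ring.
  have Ceps : 0 < C * eps by rewrite mulr_gt0.
  have Neps : 0 <= N * eps by rewrite mulr_ge0// ltW.
  by rewrite CK; clear -Cw Ceps Neps eps0; lra.
- by move: w0; rewrite dirichlet; [rewrite subrr; lra|left].
- have s1 : s = 1 by case: L2.
  have : 2 * eps * (s - 1 / 2) <= 0.
    apply: (deriv_within_min_left (bdry _ He (or_introl L2))) => [r|d d0].
      by rewrite /= in_itv/= => ?; exact: vmin.
    have [r [? ? ? ?]] := itvoo_left ltr01 d0 (lexx 1).
    by exists r; rewrite s1 /= in_itv/=; split => //; apply/andP; split; lra.
  by rewrite s1; lra.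
- by move: w0; rewrite dirichlet; [rewrite subrr; lra|right].
- have s0 : s = 0 by case: L4.
  have : 0 <= 2 * eps * (s - 1 / 2).
    apply: (deriv_within_min_right (bdry _ He (or_intror L4))) => [r|d d0].
      by rewrite /= in_itv/= => ?; exact: vmin.
    have [r [? ? ? ?]] := itvoo_right ltr01 d0 (lexx 0).
    by exists r; rewrite s0 /= in_itv/=; split => //; apply/andP; split; lra.
  by rewrite s0; lra.
Qed.

End Comparison.

(** Strict positivity enters through l4 alone, where V >= B. Each point of [Omega] gets its own
    barrier [z], and V - z is studied at its minimum over the compact cylinder. *)
Lemma parabolic_positivity {R : realType} (T M C B : R)
    (V : R * R -> R -> R) (b c : R * R -> R) :
  0 < T -> 0 < B ->
  (forall x, Omega x -> `|b x| <= M) ->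
  (forall x, Omega x -> 0 < c x <= C) ->
  continuous_on (square `*` `[0, T]) V ->
  (forall x, square x -> 0 <= V x 0) ->
  (forall x t, [\/ l1 x, l2 x | l3 x] -> 0 < t <= T -> 0 <= V x t) ->
  (forall x t, l4 x -> 0 < t <= T -> B <= V x t) ->
  (forall t, 0 < t <= T -> Ck 2 (V ^~ t)) ->
  (forall x t, Omega x -> 0 < t <= T -> derivable_in `[0, T] (V x) t) ->
  (forall x t, Omega x -> 0 < t <= T ->
     0 <= dt T V x t - laplacian (V ^~ t) x + b x * d1 (V ^~ t) x + c x * V x t) ->
  forall x, Omega x -> 0 < V x T.
Proof.
move=> T0 B0 bM cC cV Vinit V123 V4 V2 Vt eqn [s0 y0] O0.
have /OmegaP[/andP[s00 s01] /andP[y00 y01]] := O0.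
have M0 : 0 <= M by apply: le_trans (bM _ O0).
have C0 : 0 < C by case/andP: (cC _ O0) => *; lra.
(* With this [A], the quadratic term of [rho] is at least 1 on l1 and l3; likewise [k * T = 1] below
   makes [rho >= 1] at time 0. On l2 the term x1 suffices. *)
pose A := y0 ^- 2 + (1 - y0) ^- 2.
have y0V : 0 < y0 ^- 2 by rewrite invr_gt0 exprn_gt0.
have y1V : 0 < (1 - y0) ^- 2 by rewrite invr_gt0 exprn_gt0 ?subr_gt0.
have A0 : 0 < A by rewrite /A addr_gt0.
have Ay0 : 1 <= A * y0 ^+ 2.
  rewrite /A mulrDl mulVf ?lerDl; last by rewrite expf_neq0// gt_eqF.
  by rewrite mulr_ge0 ?sqr_ge0// ltW.
have Ay1 : 1 <= A * (1 - y0) ^+ 2.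
  rewrite /A mulrDl [X in _ + X]mulVf ?lerDr.
    by rewrite mulr_ge0 ?sqr_ge0// ltW.
  by rewrite expf_neq0// gt_eqF// subr_gt0.
pose k := T^-1; have k0 : 0 < k by rewrite invr_gt0.
have kT : k * T = 1 by rewrite mulVf// gt_eqF.
(* Expanding one factor of [al ^+ 2] cancels the terms in [k], [A] and [M] of the barrier inequality
   and leaves al (1 + C) - C, positive because [al >= 1]. *)
pose al := 1 + k + 2 * A + M + C.
have al0 : 0 < al by rewrite /al; lra.
pose rho (s y t : R) := s + A * (y - y0) ^+ 2 + k * (T - t).
pose E (s y t : R) := expR (- al * rho s y t).
pose z (s y t : R) := B * (E s y t - expR (- al)).
have zle0 s y t : 1 <= rho s y t -> z s y t <= 0.
  move=> rho1; rewrite /z pmulr_rle0// subr_le0 ler_expR.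
  by rewrite !mulNr lerN2 ler_peMr// ltW.
have zlt s y t : z s y t < B * E s y t.
  by rewrite /z ltr_pM2l// ltrBlDr ltrDl expR_gt0.
(* z <= 0 outside a parabolic region around (s0, y0, T) that meets the boundary
   of the cylinder only in l4, and z is a subsolution since al is large. *)
pose F (p : (R * R) * R) := V p.1 p.2 - z p.1.1 p.1.2 p.2.
have cF : {within square `*` `[0, T], continuous F}.
  move=> p; apply: cvgB; first exact: cV.
  have : {within square `*` `[0, T], continuous
      (fun p : (R * R) * R => z p.1.1 p.1.2 p.2)}.
    apply: continuous_subspaceT => -[[s y] t].
    have cs : p0.1.1 @[p0 --> ((s, y), t)] --> s.
      by apply: (@cvg_comp _ _ _ fst fst); exact: cvg_fst.
    have cy : p0.1.2 @[p0 --> ((s, y), t)] --> y.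
      by apply: (@cvg_comp _ _ _ fst snd); [exact: cvg_fst|exact: cvg_snd].
    have ct : p0.2 @[p0 --> ((s, y), t)] --> t by exact: cvg_snd.
    apply: cvgM; first exact: cvg_cst.
    apply: cvgB; last exact: cvg_cst.
    apply: continuous_cvg; first exact: continuous_expR.
    apply: cvgM; first exact: cvg_cst.
    rewrite /rho; apply: cvgD; [apply: cvgD => //; apply: cvgM|apply: cvgM].
    - exact: cvg_cst.
    - by rewrite expr2; apply: cvgM; apply: cvgB => //; exact: cvg_cst.
    - exact: cvg_cst.
    - by apply: cvgB => //; exact: cvg_cst.
  exact.
rewrite ltNge; apply/negP => Vle0.
have cyl0 : @square R `*` `[0, T] !=set0.
  by exists ((s0, y0), T); split; [exact: Omega_square|rewrite /= in_itv/= lexx ltW].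
have cylK : compact (@square R `*` `[0, T]).
  by apply: compact_setX; [exact: compact_square|exact: segment_compact].
have [[[s y] t]] := compact_EVT_min cyl0 cylK cF.
rewrite inE => -[/= sy]; rewrite in_itv/= => t0T Fmin.
have {}Fmin (s' y' t' : R) : square (s', y') -> 0 <= t' <= T ->
    V (s, y) t - z s y t <= V (s', y') t' - z s' y' t'.
  move=> ? ?; have := Fmin ((s', y'), t'); apply.
  by rewrite inE; split => //=; rewrite in_itv.
(* Compare with the value at (s0, y0, T), where [rho] is s0 < 1 and hence [z > 0], while V <= 0 by
   contradiction. *)
have Fneg : V (s, y) t - z s y t < 0.
  apply: le_lt_trans (Fmin s0 y0 T (Omega_square O0) _) _.
    by rewrite lexx ltW.
  suff : 0 < z s0 y0 T by lra.
  rewrite /z /E /rho !subrr expr2 !mulr0 !addr0 mulr_gt0// subr_gt0 ltr_expR.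
  by rewrite !mulNr ltrN2 gtr_pMr.
have /squareP[/andP[sge0 sle1] /andP[yge0 yle1]] := sy.
have /andP[tge0 tleT] := t0T.
have kt0 : 0 <= k * (T - t) by rewrite mulr_ge0 ?subr_ge0// ltW.
have Ay : 0 <= A * (y - y0) ^+ 2 by rewrite mulr_ge0 ?sqr_ge0// ltW.
have [tE|tN0] := eqVneq t 0.
  have : z s y t <= 0 by apply: zle0; rewrite /rho tE subr0 kT; lra.
  by have := Vinit _ sy; move: Fneg; rewrite tE; lra.
have t0 : 0 < t by rewrite lt_neqAle eq_sym tN0.
have tT : 0 < t <= T by rewrite t0.
have side : 1 <= rho s y t -> [\/ l1 (s, y), l2 (s, y) | l3 (s, y)] -> False.
  move=> /zle0 z0 /V123 /(_ tT); lra.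
have Osy : Omega (s, y).
  have [//|[L1|[L2|[L3|L4]]]] := square_cases sy; exfalso.
  - apply: side; last by constructor 1.
    by have [_ /= ->] := L1; rewrite /rho sub0r sqrrN; lra.
  - apply: side; last by constructor 2.
    by have [/= -> _] := L2; rewrite /rho; lra.
  - apply: side; last by constructor 3.
    by have [_ /= ->] := L3; rewrite /rho; lra.
  (* On l4 the barrier is beaten directly: [rho >= 0] gives z < B E <= B <= V. *)
  - have VB := V4 _ _ L4 tT.
    have : E s y t <= 1.
      rewrite -expR0 ler_expR mulNr oppr_le0; apply: mulr_ge0; first exact: ltW.
      by rewrite /rho; lra.
    rewrite -(ler_pM2l B0) mulr1; have := zlt s y t; lra.
have /OmegaP[sI yI] := Osy.
have Es (r u v : R) : is_derive r 1 (fun r => E r u v) (- al * E r u v).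
  have H : is_derive r 1 (fun r => - al * rho r u v) _ :=
    is_deriveZ (- al) (is_deriveD (is_deriveD (is_derive_id r 1)
      (is_derive_cst _ r 1)) (is_derive_cst _ r 1)).
  apply: (is_derive_eq (is_derive_expR_comp H)).
  by rewrite /GRing.scale/= /E; ring.
have Ey (r u v : R) : is_derive u 1 (fun u => E r u v)
    (- al * E r u v * (2 * A * (u - y0))).
  have H : is_derive u 1 (fun u => - al * rho r u v) _ :=
    is_deriveZ (- al) (is_deriveD (is_deriveD (is_derive_cst r u 1)
      (is_derive_quadratic A y0 u)) (is_derive_cst _ u 1)).
  apply: (is_derive_eq (is_derive_expR_comp H)).
  by rewrite /GRing.scale/= /E; ring.
have Et (r u v : R) : is_derive v 1 (fun v => E r u v) (al * k * E r u v).
  have H : is_derive v 1 (fun v => - al * rho r u v) _ :=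
    is_deriveZ (- al) (is_deriveD (is_derive_cst _ v 1)
      (is_deriveZ k (is_deriveB (is_derive_cst T v 1) (is_derive_id v 1)))).
  apply: (is_derive_eq (is_derive_expR_comp H)).
  by rewrite /GRing.scale/= /E; ring.
have zs (r u v : R) : is_derive r 1 (fun r => z r u v) (- al * B * E r u v).
  have H : is_derive r 1 (fun r => z r u v) _ :=
    is_deriveZ B (is_deriveB (Es r u v) (is_derive_cst _ r 1)).
  by apply: (is_derive_eq H); rewrite /GRing.scale/=; ring.
have zss (r u v : R) :
    is_derive r 1 (fun r => - al * B * E r u v) (al ^+ 2 * B * E r u v).
  have H : is_derive r 1 (fun r => - al * B * E r u v) _ :=
    is_deriveZ (- al * B) (Es r u v).
  by apply: (is_derive_eq H); rewrite /GRing.scale/=; ring.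
have zy (r u v : R) : is_derive u 1 (fun u => z r u v)
    (- al * B * E r u v * (2 * A * (u - y0))).
  have H : is_derive u 1 (fun u => z r u v) _ :=
    is_deriveZ B (is_deriveB (Ey r u v) (is_derive_cst _ u 1)).
  by apply: (is_derive_eq H); rewrite /GRing.scale/=; ring.
have zyy (r u v : R) :
    is_derive u 1 (fun u => - al * B * E r u v * (2 * A * (u - y0)))
    (al ^+ 2 * B * E r u v * (2 * A * (u - y0)) ^+ 2 - al * B * E r u v * (2 * A)).
  have H : is_derive u 1 (fun u => - al * B * E r u v * (2 * A * (u - y0))) _ :=
    is_deriveM (is_deriveZ (- al * B) (Ey r u v)) (is_derive_linear (2 * A) y0 u).
  apply: (is_derive_eq H).
  by rewrite /GRing.scale/= /GRing.scale/=; ring.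
have zt (r u v : R) : is_derive v 1 (fun v => z r u v) (al * k * B * E r u v).
  have H : is_derive v 1 (fun v => z r u v) _ :=
    is_deriveZ B (is_deriveB (Et r u v) (is_derive_cst _ v 1)).
  by apply: (is_derive_eq H); rewrite /GRing.scale/=; ring.
have W1 (r : R) : 0 < r < 1 -> is_derive r 1 (fun r => V (r, y) t - z r y t)
    (d1 (V^~ t) (r, y) - - al * B * E r y t).
  move=> rI; have Ory : Omega (r, y) by exact/OmegaP.
  have [H _ _ _] := Ck2_is_derive (V2 _ tT) Ory.
  exact: (is_deriveB H (zs r y t)).
have W2 (r : R) : 0 < r < 1 -> is_derive r 1 (fun r => V (s, r) t - z s r t)
    (d2 (V^~ t) (s, r) - - al * B * E s r t * (2 * A * (r - y0))).
  move=> rI; have Osr : Omega (s, r) by exact/OmegaP.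
  have [_ _ H _] := Ck2_is_derive (V2 _ tT) Osr.
  exact: (is_deriveB H (zy s r t)).
have [_ H11 _ H22] := Ck2_is_derive (V2 _ tT) Osy.
have min1 (r : R) : 0 < r < 1 -> V (s, y) t - z s y t <= V (r, y) t - z r y t.
  by move=> rI; apply: Fmin => //; apply/Omega_square/OmegaP.
have min2 (r : R) : 0 < r < 1 -> V (s, y) t - z s y t <= V (s, r) t - z s r t.
  by move=> rI; apply: Fmin => //; apply/Omega_square/OmegaP.
have D1 := min_is_derive0 sI (W1 s sI) min1.
have D11 := min_is_derive2_ge0 sI W1 (is_deriveB H11 (zss s y t)) min1.
have D22 := min_is_derive2_ge0 yI W2 (is_deriveB H22 (zyy s y t)) min2.
(* Only earlier times are compared, so a minimum at t = T is covered as well. *)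
have Dt : dt T V (s, y) t - al * k * B * E s y t <= 0.
  have Ht := deriv_withinB (deriv_within_derive_in (Vt _ _ Osy tT))
    (is_derive_deriv_within `[0, T] (zt s y t)).
  apply: (deriv_within_min_left Ht) => [r|d d0].
    by rewrite /= in_itv/= => rT; exact: Fmin.
  have [r [? ? ? ?]] := itvoo_left t0 d0 tleT.
  by exists r; rewrite /= in_itv/= !ltW.
have := eqn _ _ Osy tT; rewrite /laplacian leNgt => /negP; apply.
have {}D1 : d1 (V^~ t) (s, y) = - (al * B * E s y t) by clear -D1; lra.
set e := B * E s y t.
have e0 : 0 < e by rewrite mulr_gt0// expR_gt0.
have be : b (s, y) * d1 (V^~ t) (s, y) <= M * (al * e).
  apply: le_trans (ler_norm _) _; rewrite normrM; apply: ler_pM => //.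
    exact: bM.
  by rewrite D1 -mulrA normrN gtr0_norm// mulr_gt0.
(* V may have either sign, but V < z < e at the minimum and c > 0. *)
have ce : c (s, y) * V (s, y) t <= C * e.
  have /andP[c0 cle] := cC _ Osy.
  apply: (@le_trans _ _ (c (s, y) * e)); last by rewrite ler_pM2r.
  by rewrite ler_pM2l//; have := zlt s y t; rewrite -/e; clear -Fneg; lra.
have w0 : 0 <= al ^+ 2 * e * (2 * A * (y - y0)) ^+ 2.
  by rewrite mulr_ge0 ?sqr_ge0// mulr_ge0 ?sqr_ge0// ltW.
have D11' : al ^+ 2 * e <= d1 (d1 (V^~ t)) (s, y).
  by move: D11; rewrite subr_ge0 /e mulrA.
have D22' : - (al * e * (2 * A)) <= d2 (d2 (V^~ t)) (s, y).
  by move: D22 w0; rewrite /e !mulrA; clear; lra.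
have Dt' : dt T V (s, y) t <= al * k * e.
  by move: Dt; rewrite subr_le0 /e mulrA.
have key : al * k * e - al ^+ 2 * e + al * e * (2 * A) + M * (al * e) + C * e < 0.
  have -> : al * k * e - al ^+ 2 * e + al * e * (2 * A) + M * (al * e) + C * e
      = - (e * (al * (1 + C) - C)) by rewrite /al; ring.
  rewrite oppr_lt0 mulr_gt0// subr_gt0 mulrDr mulr1.
  have : 1 <= al by rewrite /al; clear -k0 A0 M0 C0; lra.
  by clear -al0 C0 => al1; nra.
by clear -be ce D11' D22' Dt' key; lra.
Qed.

(** * The fixed points of K *)

(** On a horizontal side the x1-derivative is tangential, hence determined by the Dirichlet datum,
    corners included. *)
Lemma d1_boundary {R : realType} (phi psi : R * R -> R) (l : set (R * R)) (c s : R) :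
  l = `[0, 1] `*` [set c] -> (forall x, l x -> phi x = psi x) -> l (s, c) ->
  d1 phi (s, c) = d1 psi (s, c).
Proof.
move=> -> E [/= s01 _]; apply: eq_derive_in => // r r01; exact: E.
Qed.

Lemma Cnorm1_bound {R : realType} (M : R) (psi : R * R -> R) x :
  (Cnorm 1 psi <= M%:E)%E -> Omega x -> `|psi x| <= M /\ `|d1 psi x| <= M.
Proof.
move=> psiM Ox; rewrite -!lee_fin; split; apply: le_trans psiM.
  exact: (@le_Cnorm _ 1 0 0).
exact: (@le_Cnorm _ 1 1 0).
Qed.

Lemma Omega_nonempty (R : realType) : @Omega R !=set0.
Proof. by exists (1 / 2, 1 / 2); apply/OmegaP; split; apply/andP; split; lra. Qed.

Lemma standing_M_ge0 (R : realType) (P : problem R) (M : R) (qstar : R * R -> R) :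
  standing_assumptions P M qstar -> 0 <= M.
Proof.
have [x Ox] := Omega_nonempty R => st.
by apply: le_trans (Cnorm1_bound (st_qstar_M st) Ox).1.
Qed.

(** This makes the division in [K] legitimate. The zero-order coefficient [Cp P + d1 qstar x] of the
    differentiated equation is positive because |d1 q*| <= M < Cp. *)
Lemma d1_data_gt0 (R : realType) (P : problem R) (M : R) (qstar : R * R -> R)
    (U : R * R -> R -> R) :
  standing_assumptions P M qstar -> is_solution P qstar U ->
  forall x, Omega x -> 0 < d1 (U ^~ (final_time P)) x.
Proof.
move=> st sol; set T := final_time P.
have reg := sol_regular sol.
have qM := Cnorm1_bound (st_qstar_M st).
have T0 : 0 < T := st_T st.
have M0 := standing_M_ge0 st.
have CpM := st_Cp st.
have cyl : square `*` `[0, T] `<=` closed_cylinder T.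
  by apply: setSX => //; exact: square_closure.
have cV := continuous_onS cyl (regular_cont1 reg).
have b1P := st_b1 st; have b3P := st_b3 st.
apply: (@parabolic_positivity _ T M (Cp P + M) (- b4 P) (dx1 U) qstar
  (fun x => Cp P + d1 qstar x)) => //.
- by rewrite oppr_gt0; exact: (st_b4 st).
- by move=> x /qM[].
- move=> x /qM[_]; rewrite ler_norml => /andP[? ?].
  by apply/andP; split; lra.
- have VO x : Omega x -> 0 <= dx1 U x 0.
    move=> Ox; rewrite /dx1 (eq_d1 (sol_init sol) Ox).
    exact: (st_u0_sign st Ox).
  (* The initial condition gives the sign on the open square only; density and the continuity of
     [dx1 U] carry it to the sides. *)
  move=> [s y] sy; rewrite leNgt; apply/negP => neg.
  have mem0 (s' y' : R) : square (s', y') -> (square `*` `[0, T]) ((s', y'), 0).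
    by move=> ?; split => //=; rewrite in_itv/= lexx ltW.
  have e0 : 0 < - dx1 U (s, y) 0 by lra.
  have [d d0 dP] := continuous_onP cV (mem0 _ _ sy) e0.
  have /squareP[s01 y01] := sy.
  have [s' s'01 s'd] := unit_interval_dense s01 d0.
  have [y' y'01 y'd] := unit_interval_dense y01 d0.
  have Osy' : Omega (s', y') by exact/OmegaP.
  have := dP s' y' 0 s'd y'd _ (mem0 _ _ (Omega_square Osy')).
  rewrite subrr normr0 ltr_norml => /(_ d0)/andP[_].
  have := VO _ Osy'; lra.
- move=> [s y] t side tT; case: side => side.
  + have y0 : y = 0 by case: side.
    rewrite /dx1 y0 (@d1_boundary _ _ (b1 P ^~ t) l1)//.
    * by rewrite y0 in side; have [] := dir_sign b1P side tT.
    * by move=> x /(sol_l1 sol); exact.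
    * by rewrite -y0.
  + by rewrite /dx1 (sol_l2 sol)//; have [] := st_b2_sign st side tT.
  + have y1 : y = 1 by case: side.
    rewrite /dx1 y1 (@d1_boundary _ _ (b3 P ^~ t) l3)//.
    * by rewrite y1 in side; have [] := dir_sign b3P side tT.
    * by move=> x /(sol_l3 sol); exact.
    * by rewrite -y1.
- by move=> x t l4x tT; rewrite -(sol_l4 sol l4x tT) opprK.
- by move=> t tT; exact: (C21_space (regular_C21_1 reg) tT).
- by move=> x t Ox tT; exact: (C21_time (regular_C21_1 reg) Ox tT).
- move=> x t Ox tT.
  rewrite (differentiated_equation sol (st_qstar st) Ox tT).
  apply: le_trans (st_f1 st Ox); rewrite mulr_ge0 ?fine_C0_ge0//.
  by have := CpM; have := M0; lra.
Qed.

Theorem lemma3p1 (R : realType) (P : problem R) (M : R) (qstar : R * R -> R)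
    (u : (R * R -> R) -> R * R -> R -> R) (q : R * R -> R) :
  let g : R * R -> R := fun x => u qstar x (final_time P) in
  standing_assumptions P M qstar ->
  is_solution P qstar (u qstar) ->
  is_solution P q (u q) ->
  D_K P g q ->
  (forall x, Omega x -> u q x (final_time P) = g x) <->
  (forall x, Omega x -> K P u g q x = q x).
Proof.
move=> g st solg solq qDK; set T := final_time P.
have T0 : 0 < T := st_T st.
have TT : 0 < T <= T by rewrite T0 lexx.
have g1 x (Ox : Omega x) : d1 g x != 0 by rewrite gt_eqF//; exact: (d1_data_gt0 st solg Ox).
have eqq x (Ox : Omega x) := sol_eq solq Ox TT.
split=> [E x Ox|fix_q].
  (* After multiplication by [d1 g], the claim is the equation of [u q] at the final time with [u q]
     replaced by [g]. *)
  apply: (mulIf (g1 x Ox)); rewrite /K divfK ?g1//.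
  rewrite -(eqq x Ox) -(eq_laplacian E Ox) -(eq_d1 E Ox) -(E x Ox) -/T.
  by ring.
have regq := sol_regular solq; have regg := sol_regular solg.
have slice U : continuous_on (closed_cylinder T) U ->
    {within square, continuous (U ^~ T)}.
  move=> cU; apply/subspace_continuousP => -[s y] sy; apply/cvgrPdist_lt => e e0.
  have mem x : square x -> closed_cylinder T (x, T).
    move=> ?; split; first exact: square_closure.
    by rewrite /= in_itv/= lexx ltW.
  have [d d0 dP] := continuous_onP cU (mem _ sy) e0.
  suff : \forall x \near (s, y), square x -> `|U (s, y) T - U x T| < e by [].
  apply/nbhs_ballP; exists d => //= -[s' y'] [/=]; rewrite /ball/= => ds dy s'y'.
  by rewrite distrC; apply: dP; rewrite ?subrr ?normr0// 1?distrC//; exact: mem.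
(* Membership in [D_K] makes the C^1 norm of [q] finite; it bounds the drift in the comparison. *)
have [[_ qfin] _] := qDK.
have qN x : Omega x -> `|q x| <= fine (Cnorm 1 q).
  move=> Ox; have qx := @le_Cnorm _ 1 0 0 q x isT Ox.
  by rewrite -lee_fin fineK// ge0_fin_numE// (le_trans _ qx)// lee_fin.
have edge x : l2 x \/ l4 x -> closed_cylinder T (x, T).
  move=> lx; split; last by rewrite /= in_itv/= lexx ltW.
  apply: square_closure; case: x lx => s y.
  by case=> -[/= ->]; rewrite in_itv/= => /andP[? ?]; apply/squareP;
    split; apply/andP; split; lra.
have eqn x : Omega x ->
    laplacian (u q ^~ T) x - q x * d1 (u q ^~ T) x - Cp P * u q x T =
    laplacian g x - q x * d1 g x - Cp P * g x.
  move=> Ox.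
  (* The fixed-point identity times [d1 g] is a stationary equation for [g] with drift [q] and
     right-hand side f - d_t u(q) at time T; the slice of [u q] at T solves the same one. *)
  have : K P u g q x * d1 g x = q x * d1 g x by rewrite fix_q.
  rewrite /K divfK ?g1// -(eqq x Ox) -/T => H; lra.
have Cp0 : 0 < Cp P by apply: le_lt_trans (standing_M_ge0 st) (st_Cp st).
have C2q := C21_space (regular_C21 regq) TT.
have C2g := C21_space (regular_C21 regg) TT.
have cq := slice _ (regular_cont regq).
have cg := slice _ (regular_cont regg).
have dir x : l1 x \/ l3 x -> u q x T = g x.
  case=> lx; first by rewrite /g (sol_l1 solq lx TT) (sol_l1 solg lx TT).
  by rewrite /g (sol_l3 solq lx TT) (sol_l3 solg lx TT).
have neu x : l2 x \/ l4 x -> [/\ derivable1 (u q ^~ T) x, derivable1 g x &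
    d1 (u q ^~ T) x = d1 g x].
  move=> lx; split.
  - exact: (regular_ex1 regq (edge _ lx)).
  - exact: (regular_ex1 regg (edge _ lx)).
  - case: lx => lx; first by rewrite (sol_l2 solq lx TT) (sol_l2 solg lx TT).
    by apply: oppr_inj; rewrite (sol_l4 solq lx TT) (sol_l4 solg lx TT).
move=> x Ox; apply/le_anti/andP; split.
  apply: (elliptic_comparison Cp0 qN C2g C2q cg cq _ _ _ Ox) => y Hy.
  - by rewrite dir.
  - by have [] := neu y Hy.
  - by rewrite eqn.
exact: (elliptic_comparison Cp0 qN C2q C2g cq cg dir neu eqn Ox).
Qed.
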